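(* Let $n\ge1$ be an integer, and let a society consist of $n$ egoists, the utility increments in a random proposal being independent random variables with a continuous uniform distribution with mean $\mu\in\mathbb{R}$ and standard deviation $\sigma>0$. Let $\rho=\mu/\sigma$. Then $$\alpha_0=\begin{cases}1, & \rho\le-\sqrt3,\\ \frac12\left(1-\frac{\rho}{\sqrt3}\right), & -\sqrt3<\rho<\sqrt3,\\ 0, & \rho\ge\sqrt3\end{cases}$$ is an optimal majority/acceptance threshold, i.e. $\mathrm{E}(\eta_i(\alpha_0))\ge \mathrm{E}(\eta_i(\alpha))$ for every $\alpha\in[-\frac1n,1]$ and every $i\in\{1,\dots,n\}$.
   Context: Setting (ViSE model, society of $n$ egoists): a random proposal is a vector $\boldsymbol\zeta=(\zeta_1,\ldots,\zeta_n)$ of independent identically distributed real random variables; $\zeta_i$ is the proposed utility increment of agent $i$. Each agent votes for the proposal if and only if his/her own proposed increment is positive. For a relative voting threshold $\alpha\in[-\frac1n,1]$, the proposal is accepted if and only if $\#\{k:\zeta_k>0,\ k=1,\ldots,n\}>\alpha n$. The actual utility increments are $\eta_i(\alpha)=\zeta_i\, I(\boldsymbol\zeta,\alpha n)$, where $I(\boldsymbol\zeta,\alpha n)=1$ if $\#\{k:\zeta_k>0\}>\alpha n$ and $I(\boldsymbol\zeta,\alpha n)=0$ otherwise. A threshold in $[-\frac1n,1]$ is called optimal if it provides the highest possible expected utility increment $\mathrm{E}(\eta_i(\alpha))$ of an agent (this expectation does not depend on $i$); optimal thresholds are not unique. The number $\rho=\mu/\sigma$ is called the adjusted mean of the environment.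 *)

(* Defs.v *)
From HB Require Import structures.
From mathcomp Require Import all_boot all_order all_algebra.
From mathcomp Require Import all_classical all_reals all_analysis.

Set Implicit Arguments.
Unset Strict Implicit.
Unset Printing Implicit Defensive.

Import Order.TTheory GRing.Theory Num.Theory.
Import numFieldNormedType.Exports.

Local Open Scope classical_set_scope.
Local Open Scope ring_scope.

(* Mutual independence: the product rule over every subfamily. *)
Definition mutually_independent d (T : measurableType d) (R : realType)
    (P : probability T R) (I : finType) (X : I -> {RV P >-> R}) : Prop :=
  forall (J : {set I}) (B : I -> set R), (forall i, measurable (B i)) ->
    P (\bigcap_(i in [set` J]) (X i @^-1` B i)) =
    (\prod_(i in J) P (X i @^-1` B i))%E.

Definition uniformly_distributed d (T : measurableType d) (R : realType)
    (P : probability T R) (X : {RV P >-> R}) : Prop :=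
  exists (a b : R) (ab : a < b), forall A : set R, measurable A ->
    distribution P X A = uniform_prob ab A.

Definition standard_deviation d (T : measurableType d) (R : realType)
    (P : probability T R) (X : {RV P >-> R}) : \bar R :=
  sqrte 'V_P[X].

Section vise.
Context (R : realType) (n : nat).

(* Agent k votes for the proposal z iff 0 < z k; t is an absolute threshold. *)
Definition accepted (z : 'I_n -> R) (t : R) : bool :=
  t < #|[pred k : 'I_n | 0 < z k]|%:R.

Definition actual_increment (z : 'I_n -> R) (alpha : R) (i : 'I_n) : R :=
  z i * (accepted z (alpha * n%:R))%:R.

Definition admissible_threshold (alpha : R) : Prop :=
  - n%:R^-1 <= alpha <= 1.

Definition expected_increment d (T : measurableType d) (P : probability T R)
    (zeta : 'I_n -> {RV P >-> R}) (alpha : R) (i : 'I_n) : \bar R :=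
  'E_P[fun w => actual_increment (fun k => zeta k w) alpha i].

Definition optimal_threshold d (T : measurableType d) (P : probability T R)
    (zeta : 'I_n -> {RV P >-> R}) (alpha0 : R) : Prop :=
  admissible_threshold alpha0 /\
  forall (alpha : R) (i : 'I_n), admissible_threshold alpha ->
    (expected_increment zeta alpha i <= expected_increment zeta alpha0 i)%E.

End vise.

Definition uniform_threshold (R : realType) (rho : R) : R :=
  if rho <= - Num.sqrt 3 then 1
  else if rho < Num.sqrt 3 then 2^-1 * (1 - rho / Num.sqrt 3)
  else 0.

(* Main.v *)
Require Import Defs.
From HB Require Import structures.
From mathcomp Require Import all_boot all_order all_algebra.
From mathcomp Require Import all_classical all_reals all_analysis.
From mathcomp Require Import ring lra perm measurable_realfun.

Set Implicit Arguments.
Unset Strict Implicit.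
Unset Printing Implicit Defensive.

Import Order.TTheory GRing.Theory Num.Theory.
Import numFieldNormedType.Exports.

Local Open Scope classical_set_scope.
Local Open Scope ring_scope.

(** The expected increment of agent i splits over the set S of agents who vote
    for the proposal.  Acceptance depends only on |S|, so by independence S
    contributes w(S) * c(i \in S) when |S| > alpha n and nothing otherwise,
    where w(S) is the probability of the voting pattern S and c(true),
    c(false) are the means of an increment given that it is positive,
    respectively nonpositive ([expected_incrementE]).

    The agents are exchangeable: a transposition of the indices shows that the
    resulting sum is the same for all i ([mean_increment_sym]).  Averaging over
    i therefore replaces c(i \in S) by the total gain of the pattern,
    |S| c(true) + (n - |S|) c(false).  A threshold is then optimal as soon as it
    accepts every pattern of positive weight whose gain is positive and rejects
    every one whose gain is negative ([mean_increment_max]).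

    It remains to read off the sign of the gain for the uniform law.  Mean mu
    and standard deviation sigma force the support to be [a, b] with
    a = mu - sqrt 3 sigma and b = mu + sqrt 3 sigma ([uniform_parameters]).
    When a < 0 < b the conditional means are b / 2 and a / 2, the midpoints of
    the two parts of the support, so the gain is (|S| (b - a) + n a) / 2; it
    changes sign at |S| = alpha n for alpha = - a / (b - a), which is
    (1 - rho / sqrt 3) / 2.  When b <= 0 or a >= 0, one of the two votes has
    probability zero, the only pattern of positive weight is unanimous, and the
    sign of its gain is that of mu ([pattern_gain_sign]). *)

(** * Exchangeable voting patterns *)

Section voting_patterns.
Context (R : realType) (n : nat) (pr cm : bool -> R).
Implicit Types (S : {set 'I_n}) (alpha : R) (i : 'I_n).

Definition pattern_weight S : R := \prod_k pr (k \in S).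

(** The expected increment of agent i, when a vote s has probability pr s and an
    increment has mean cm s given that vote. *)
Definition mean_increment alpha i : R :=
  \sum_(S : {set 'I_n}) (alpha * n%:R < #|S|%:R)%R%:R *
     (pattern_weight S * cm (i \in S)).

Definition pattern_gain S : R :=
  #|S|%:R * cm true + (n - #|S|)%:R * cm false.

(** Weight and size of a pattern are invariant under permutations of the agents,
    so exchanging i and j in every pattern carries one sum to the other. *)
Lemma mean_increment_sym alpha i j :
  mean_increment alpha i = mean_increment alpha j.
Proof.
have tK : involutive (fun S : {set 'I_n} => tperm i j @: S).
  move=> S; rewrite -imset_comp -[RHS]imset_id; apply: eq_imset => k /=.
  by rewrite tpermK.
have tE S k : (k \in tperm i j @: S) = (tperm i j k \in S).
  by rewrite -{1}(tpermK i j k) mem_imset//; exact: perm_inj.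
rewrite /mean_increment [LHS](reindex_inj (inv_inj tK))/=.
apply: eq_bigr => S _; rewrite card_imset; last exact: perm_inj.
rewrite tE tpermL; congr (_ * (_ * _)).
rewrite /pattern_weight [LHS](reindex_inj (@perm_inj _ (tperm i j)))/=.
by apply: eq_bigr => k _; rewrite tE tpermK.
Qed.

Lemma sum_mean_increment alpha :
  \sum_i mean_increment alpha i =
  \sum_(S : {set 'I_n}) (alpha * n%:R < #|S|%:R)%R%:R *
     (pattern_weight S * pattern_gain S).
Proof.
rewrite exchange_big/=; apply: eq_bigr => S _.
rewrite -!mulr_sumr; congr (_ * (_ * _)).
rewrite (bigID (mem S))/= /pattern_gain.
rewrite (eq_bigr (fun=> cm true)) => [|k ->//].
rewrite [X in _ + X](eq_bigr (fun=> cm false)) => [|k /negbTE ->//].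
rewrite !sumr_const !mulr_natl; congr (_ *+ _ + _ *+ _).
by rewrite -[n in (n - _)%N]card_ord -(cardC (mem S)) addKn.
Qed.

(** By symmetry it suffices to compare the sums over all agents, where an
    accepted pattern contributes its weighted gain and a rejected one nothing, so
    that alpha0 takes the better decision on each pattern separately. *)
Lemma mean_increment_max alpha0 alpha i :
  (forall s, 0 <= pr s) ->
  (forall S, pattern_weight S != 0 ->
     if alpha0 * n%:R < #|S|%:R then 0 <= pattern_gain S
     else pattern_gain S <= 0) ->
  mean_increment alpha i <= mean_increment alpha0 i.
Proof.
move=> pr0 gain.
have n0 : (0 < n)%N by rewrite -[n]card_ord; apply/card_gt0P; exists i.
have sumE a : \sum_j mean_increment a j = mean_increment a i *+ n.
  under eq_bigr do rewrite (mean_increment_sym a _ i).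
  by rewrite sumr_const card_ord.
have : mean_increment alpha i *+ n <= mean_increment alpha0 i *+ n.
  rewrite -!sumE !sum_mean_increment; apply: ler_sum => S _.
  have [->|wS] := eqVneq (pattern_weight S) 0; first by rewrite !(mul0r, mulr0).
  have wS0 : 0 <= pattern_weight S by apply: prodr_ge0.
  move: (gain S wS); case: ifP => _ gS; rewrite ?mul1r ?mul0r.
    by case: (_ < _); rewrite ?mul1r ?mul0r// mulr_ge0.
  by case: (_ < _); rewrite ?mul1r ?mul0r// mulr_ge0_le0.
by rewrite lerMn2r eqn0Ngt n0.
Qed.

End voting_patterns.

(** * Integrals over independent events *)

Section independent_event.
Context (R : realType) d (T : measurableType d) (P : probability T R).
Variables (X : {RV P >-> R}) (F : set T).
Hypotheses (mF : measurable F)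
  (XF : forall A : set R, measurable A ->
    P (X @^-1` A `&` F) = (P F * P (X @^-1` A))%E).

(** Independence says that the image under X of P restricted to F is the law of X
    scaled by P F; both sides integrate f against that measure. *)
Let ge0_integral_indep (f : R -> \bar R) :
  measurable_fun setT f -> (forall x, 0 <= f x)%E ->
  (\int[P]_(w in F) f (X w) = P F * \int[P]_w f (X w))%E.
Proof.
move=> mf f0.
have mX : measurable_fun setT X by [].
have mfX : measurable_fun setT (f \o X) by exact: measurableT_comp.
have PF0 : 0 <= fine (P F) by exact: fine_ge0.
pose PF := NngNum PF0.
rewrite -(@eq_measure_integral _ _ _ F P (mrestr P mF)); last first.
  by move=> A mA AF; rewrite /= /mrestr setIidl.
(* The complement of F is negligible for the restriction of P to F. *)
have -> : (\int[mrestr P mF]_(w in F) f (X w) = \int[mrestr P mF]_w f (X w))%E.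
  rewrite [RHS](ge0_negligible_integral (measurableC mF))//.
    by rewrite setTD setCK.
  by rewrite /= /mrestr setICl measure0.
rewrite -[in LHS](preimage_setT X).
rewrite -(ge0_integral_pushforward mX)//.
rewrite (@eq_measure_integral _ _ _ _ (mscale PF (pushforward P X)));
  last first.
  move=> A mA _; rewrite /= /mscale/= /pushforward /mrestr XF// fineK//.
  exact: fin_num_measure.
rewrite ge0_integral_mscale// (ge0_integral_pushforward mX)//.
by rewrite fineK// fin_num_measure.
Qed.

Lemma integral_indep (f : R -> R) : measurable_fun setT f ->
  P.-integrable setT (fun w => (f (X w))%:E) ->
  (\int[P]_(w in F) (f (X w))%:E = P F * \int[P]_w (f (X w))%:E)%E.
Proof.
move=> /measurable_EFinP mf intf.
rewrite integralE [in RHS]integralE muleBr ?fin_num_measure//; last first.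
  exact: integrable_add_def.
have -> : (fun w => (f (X w))%:E) = (EFin \o f) \o X by [].
rewrite funepos_comp funeneg_comp/=.
rewrite (ge0_integral_indep (measurable_funepos mf))//.
by rewrite (ge0_integral_indep (measurable_funeneg mf)).
Qed.

End independent_event.

(** * The expected increment as a sum over voting patterns *)

(** The increments leading to vote s: s = true is a vote for the proposal. *)
Definition vote_set (R : realType) (s : bool) : set R :=
  [set x : R | (0 < x) = s].
Arguments vote_set {R} s.

Lemma measurable_vote_set (R : realType) s : measurable (vote_set s : set R).
Proof.
rewrite (_ : vote_set s = if s then `]0, +oo[%classic else `]-oo, 0]%classic).
  by case: s.
apply/seteqP; split => x; rewrite /vote_set; case: s => /=;
  rewrite in_itv/= ?andbT//.
- by move=> /negbT; rewrite -leNgt.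
- by rewrite leNgt => /negbTE.
Qed.

Section expected_increment_formula.
Context (R : realType) d (T : measurableType d) (P : probability T R) (n : nat).
Variable zeta : 'I_n -> {RV P >-> R}.

(** Leaving agent i out makes this event independent of zeta i. *)
Definition others_vote (S : {set 'I_n}) (i : 'I_n) : set T :=
  \bigcap_(k in [set` ~: [set i]%SET]) (zeta k @^-1` vote_set (k \in S)).

Lemma measurable_others_vote S i : measurable (others_vote S i).
Proof.
apply: fin_bigcap_measurable => [|k _]; first exact: finite_finset.
by apply: measurable_funPTI; exact: measurable_vote_set.
Qed.

Hypothesis indep : mutually_independent zeta.

Lemma indep_others_vote S i (A : set R) : measurable A ->
  P (zeta i @^-1` A `&` others_vote S i) =
  (P (others_vote S i) * P (zeta i @^-1` A))%E.
Proof.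
move=> mA.
(* The product rule for the sets B covers both the pattern of the others and its
   intersection with the event on zeta i. *)
pose B k := if k == i then A else vote_set (k \in S).
have mB k : measurable (B k).
  by rewrite /B; case: ifP => // _; exact: measurable_vote_set.
have -> : others_vote S i =
    \bigcap_(k in [set` ~: [set i]%SET]) (zeta k @^-1` B k).
  by apply: eq_bigcapr => k /=; rewrite !inE /B => /negbTE ->.
have -> : zeta i @^-1` A `&`
      \bigcap_(k in [set` ~: [set i]%SET]) (zeta k @^-1` B k) =
    \bigcap_(k in [set` [set: 'I_n]%SET]) (zeta k @^-1` B k).
  apply/seteqP; split => [w [iA oB] k _|w wB].
    have [->|ki] := eqVneq k i; first by rewrite /B eqxx.
    by apply: oB; rewrite /= !inE.
  split; last by move=> k _; apply: wB; rewrite /= inE.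
  by have := wB i; rewrite /B eqxx; apply; rewrite /= inE.
rewrite !indep// (bigD1 i) ?inE//= muleC; congr (_ * _)%E.
  by apply: eq_bigl => k; rewrite !inE.
by rewrite /B eqxx.
Qed.

Lemma actual_increment_patterns (z : 'I_n -> R) (alpha : R) (i : 'I_n) :
  actual_increment z alpha i =
  \sum_(S : {set 'I_n}) (alpha * n%:R < #|S|%:R)%R%:R *
     (z i * [forall k, (0 < z k)%R == (k \in S)]%:R).
Proof.
(* Only the pattern S0 that z realizes contributes. *)
pose S0 := [set k | 0 < z k]%SET.
rewrite (bigD1 S0)//= big1 => [|S SS0].
  have -> : [forall k, (0 < z k)%R == (k \in S0)] = true.
    by apply/forallP => k; rewrite inE.
  rewrite addr0 mulr1 mulrC /actual_increment /accepted.
  congr (z i * (_ < _%:R)%R%:R).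
  by apply: eq_card => k; rewrite !inE.
have -> : [forall k, (0 < z k)%R == (k \in S)] = false; last by rewrite !mulr0.
apply: contraNF SS0 => /forallP h; apply/eqP/setP => k.
by rewrite inE -(eqP (h k)).
Qed.

Variables (pr cm : bool -> R).
Hypothesis vote_pr : forall i s, P (zeta i @^-1` vote_set s) = (pr s)%:E.
Hypothesis intz : forall i, P.-integrable setT (EFin \o zeta i).
Hypothesis vote_mean : forall i s,
  (\int[P]_(w in zeta i @^-1` vote_set s) (zeta i w)%:E = (pr s * cm s)%:E)%E.

Let voted (s : bool) (x : R) : R := x * ((0 < x)%R == s)%:R.

Let measurable_voted s : measurable_fun setT (voted s).
Proof.
apply: measurable_funM => //.
rewrite (_ : (fun x : R => ((0 < x)%R == s)%:R) = \1_(vote_set s)).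
  by apply: measurable_indic; exact: measurable_vote_set.
apply/funext => x; rewrite indicE; congr ((nat_of_bool _)%:R).
by apply/idP/idP; rewrite inE /vote_set/= => /eqP.
Qed.

Let integrable_voted i s :
  P.-integrable setT (fun w => (voted s (zeta i w))%:E).
Proof.
apply: le_integrable (intz i) => //.
  by apply/measurable_EFinP; apply: measurableT_comp.
move=> w _; rewrite lee_fin /= /voted normrM ler_piMr//.
by case: (_ == s); rewrite ?normr1 ?normr0.
Qed.

Let integral_voted i s :
  (\int[P]_w (voted s (zeta i w))%:E = (pr s * cm s)%:E)%E.
Proof.
rewrite -(vote_mean i) [RHS]integral_mkcond; apply: eq_integral => w _.
rewrite patchE /voted.
case: ifPn => [/set_mem/= ->|]; first by rewrite eqxx mulr1.
by rewrite notin_setE /vote_set/= => /eqP/negbTE ->; rewrite mulr0.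
Qed.

(** On the pattern S the increment of agent i is a function of zeta i alone,
    restricted to an event about the other agents, so its integral is the
    probability of that event times the integral of zeta i over its own vote. *)
Lemma expected_incrementE (alpha : R) (i : 'I_n) :
  expected_increment zeta alpha i =
  (mean_increment pr cm alpha i)%:E.
Proof.
pose term (S : {set 'I_n}) w :=
  voted (i \in S) (zeta i w) * \1_(others_vote S i) w.
have termE (S : {set 'I_n}) w :
    zeta i w * [forall k, (0 < zeta k w)%R == (k \in S)]%:R = term S w.
  rewrite /term /voted -mulrA; congr (_ * _).
  rewrite indicE -natrM mulnb; congr ((nat_of_bool _)%:R).
  apply/forallP/andP => [h|[hi]].
    split => //; rewrite inE => k _; exact/eqP.
  rewrite inE => h k; have [->//|ki] := eqVneq k i.
  by apply/eqP/h; rewrite /= !inE.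
have termI S : (fun w => (term S w)%:E) =
    (fun w => (voted (i \in S) (zeta i w))%:E) \_ (others_vote S i).
  apply/funext => w; rewrite patchE /term indicE.
  by case: ifP; rewrite ?mulr1 ?mulr0.
have iterm S : P.-integrable setT (fun w => (term S w)%:E).
  rewrite termI; apply/(integrable_mkcond _ (measurable_others_vote S i)).
  apply: integrableS (integrable_voted i _) => //.
  exact: measurable_others_vote.
have integral_term S :
    (\int[P]_w (term S w)%:E = (pattern_weight pr S * cm (i \in S))%:E)%E.
  rewrite termI -integral_mkcond.
  rewrite (integral_indep (measurable_others_vote S i))//; last first.
    by move=> A; exact: indep_others_vote.
  rewrite integral_voted /others_vote indep//; last first.
    by move=> k; exact: measurable_vote_set.
  under eq_bigr do rewrite vote_pr.
  rewrite prodEFin -EFinM mulrA; congr (_ * _)%:E.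
  rewrite [RHS](bigD1 i)//= mulrC; congr (_ * _).
  by apply: eq_bigl => k; rewrite !inE.
rewrite /expected_increment unlock.
under eq_integral => w _.
  rewrite actual_increment_patterns.
  under eq_bigr do rewrite termE.
  rewrite -sumEFin.
  over.
rewrite integral_sum//; last first.
  by move=> S; under eq_fun do rewrite EFinM; exact: integrableZl.
rewrite -sumEFin; apply: eq_bigr => S _.
under eq_integral do rewrite EFinM.
by rewrite integralZl// integral_term.
Qed.

End expected_increment_formula.

(** * Moments of the uniform law *)

Section uniform_integral.
Context (R : realType).
Implicit Types a b c : R.

Lemma is_derive_subrX c (n : nat) (x : R) :
  is_derive x 1 (fun y : R => (y - c) ^+ n) (n%:R * (x - c) ^+ n.-1).
Proof.
have dX : is_derive x (1 : R) (id - cst c : R -> R) (1 - 0).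
  exact: is_deriveB.
rewrite [X in is_derive _ _ X _](_ : _ = (id - cst c) ^+ n).
  by have := is_deriveX n dX; rewrite subr0 /GRing.scale/= mulr1.
by apply/funext => y; rewrite fctE.
Qed.

Lemma continuous_subrX c (n : nat) : continuous (fun y : R => (y - c) ^+ n).
Proof.
move=> x; apply: differentiable_continuous; apply/derivable1_diffP.
exact: (@ex_derive _ _ _ _ _ _ _ (is_derive_subrX c n x)).
Qed.

Lemma integral_subrX a b c (n : nat) : a <= b ->
  (\int[lebesgue_measure]_(x in `[a, b]) ((x - c) ^+ n)%:E =
   (((b - c) ^+ n.+1 - (a - c) ^+ n.+1) / n.+1%:R)%:E)%E.
Proof.
rewrite le_eqVlt => /predU1P[<-|ab].
  by rewrite set_itv1 integral_set1 subrr mul0r.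
pose F : R -> R := n.+1%:R^-1 \*: (fun y : R => (y - c) ^+ n.+1).
have dF (x : R) : is_derive x 1 F ((x - c) ^+ n).
  have := is_deriveZ n.+1%:R^-1 (is_derive_subrX c n.+1 x).
  by rewrite /GRing.scale/= mulrA mulVf ?pnatr_eq0// mul1r.
have cF : continuous F.
  move=> x; apply: differentiable_continuous; apply/derivable1_diffP.
  exact: (@ex_derive _ _ _ _ _ _ _ (dF x)).
rewrite (@continuous_FTC2 _ _ F)//.
- by rewrite -EFinB /F /GRing.scale/= -mulrBr mulrC.
- exact/continuous_subspaceT/continuous_subrX.
- split; [by move=> x _; exact: (@ex_derive _ _ _ _ _ _ _ (dF x))| |].
  + exact/cvg_at_right_filter/cF.
  + exact/cvg_at_left_filter/cF.
- by move=> x _; rewrite derive1E; exact: (@derive_val _ _ _ _ _ _ _ (dF x)).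
Qed.

(** The density formula for a nonnegative integrand applies to the positive and
    the negative part of f; integrability makes their difference meaningful. *)
Lemma integrable_integral_uniform a b (ab : a < b)
    (f : measurableTypeR R -> R) :
  measurable_fun setT f ->
  lebesgue_measure.-integrable `[a, b] (EFin \o f) ->
  (uniform_prob ab).-integrable setT (EFin \o f) /\
  (\int[uniform_prob ab]_x (f x)%:E =
   (b - a)^-1%:E * \int[lebesgue_measure]_(x in `[a, b]) (f x)%:E)%E.
Proof.
move=> mf intf.
have /measurable_EFinP mEf := mf.
have ba : (0 <= (b - a)^-1%:E :> \bar R)%E.
  by rewrite lee_fin invr_ge0 subr_ge0 ltW.
split.
  apply/integrableP; split => //.
  rewrite integral_uniform//; last exact: measurableT_comp.
  by rewrite lte_mul_pinfty//; case/integrableP: intf.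
rewrite integralE [in RHS]integralE muleBr//.
- rewrite integral_uniform ?integral_uniform//.
  + exact: measurable_funeneg.
  + exact: measurable_funepos.
- exact: integrable_add_def.
Qed.

End uniform_integral.

(** Up to the point 0, the increments of [a, b] with vote s form the interval
    from clip s a to clip s b.  This also holds for a support on one side of 0,
    where one of the two intervals is degenerate. *)
Definition clip (R : realType) (s : bool) (x : R) : R :=
  if s then Num.max x 0 else Num.min x 0.

Definition vote_prob (R : realType) (a b : R) s : R :=
  (clip s b - clip s a) / (b - a).

(** The mean of a uniform law restricted to an interval is the midpoint. *)
Definition vote_cmean (R : realType) (a b : R) s : R :=
  (clip s b + clip s a) / 2.

Lemma clip_le (R : realType) s (x y : R) : x <= y -> clip s x <= clip s y.
Proof.
by move=> xy; rewrite /clip; case: s; [apply: le_max2|apply: le_min2].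
Qed.

Section uniform_moments.
Context (R : realType) d (T : measurableType d) (P : probability T R).
Variables (X : {RV P >-> R}) (a b : R) (ab : a < b).
Hypothesis X_uniform :
  forall A : set R, measurable A -> distribution P X A = uniform_prob ab A.

(** X as a map into the Borel space that carries Lebesgue measure. *)
Let Y : T -> measurableTypeR R := X.

Let mY : measurable_fun setT Y.
Proof. exact: (measurable_funPT X). Qed.

Let measurable_subrX c (n : nat) :
  measurable_fun setT (fun x : R => (x - c) ^+ n).
Proof. by apply: measurable_funX; exact: measurable_funB. Qed.

Let integrable_subrX c (n : nat) :
  lebesgue_measure.-integrable `[a, b] (fun x : R => ((x - c) ^+ n)%:E).
Proof.
apply: continuous_compact_integrable; first exact: segment_compact.
exact/continuous_subspaceT/continuous_subrX.
Qed.

Let pushforward_uniform (A : set (measurableTypeR R)) :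
  measurable A -> A `<=` setT -> pushforward P Y A = uniform_prob ab A.
Proof. by move=> mA _; exact: X_uniform. Qed.

Let ge0_integral_uniform_law (g : measurableTypeR R -> \bar R) :
  measurable_fun setT g -> (forall x, 0 <= g x)%E ->
  (\int[P]_w g (X w) = \int[uniform_prob ab]_x g x)%E.
Proof.
move=> mg g0; have := ge0_integral_pushforward mY P measurableT mg (in1W g0).
rewrite preimage_setT => <-.
exact: eq_measure_integral pushforward_uniform.
Qed.

Let integral_uniform_law (g : measurableTypeR R -> \bar R) :
  measurable_fun setT g -> P.-integrable setT (g \o X) ->
  (\int[P]_w g (X w) = \int[uniform_prob ab]_x g x)%E.
Proof.
move=> mg ig; have := integral_pushforward mY mg (D := setT).
rewrite preimage_setT => /(_ _ ig measurableT) <-.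
exact: eq_measure_integral pushforward_uniform.
Qed.

Lemma uniform_integrable c (n : nat) :
  P.-integrable setT (fun w => ((X w - c) ^+ n)%:E).
Proof.
have [+ _] := integrable_integral_uniform ab (measurable_subrX c n)
  (integrable_subrX c n).
move=> /integrableP[/= mf fin]; apply/integrableP; split.
  exact: (measurableT_comp mf mY).
rewrite (@ge0_integral_uniform_law (fun x => `|((x - c) ^+ n)%:E|%E))//.
exact: measurableT_comp.
Qed.

Lemma uniform_integral (D : set R) c (n : nat) : measurable D ->
  (\int[P]_(w in X @^-1` D) ((X w - c) ^+ n)%:E =
   (b - a)^-1%:E *
     \int[lebesgue_measure]_(x in `[a, b] `&` D) ((x - c) ^+ n)%:E)%E.
Proof.
move=> mD; pose f : R -> R := (fun x => (x - c) ^+ n) \_ D.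
have mf : measurable_fun setT f.
  by apply/(measurable_restrictT _ mD); exact: measurable_funTS.
have fE : EFin \o f = (fun x => ((x - c) ^+ n)%:E) \_ D.
  by rewrite -restrict_EFin.
have intf : lebesgue_measure.-integrable `[a, b] (EFin \o f).
  rewrite fE; apply/integrable_restrict => //.
  apply: integrableS (integrable_subrX c n) => //.
  exact: measurableI.
have mXD : measurable (X @^-1` D) by exact: measurable_funPTI.
have fXE : (fun w => ((X w - c) ^+ n)%:E) \_ (X @^-1` D) = (EFin \o f) \o X.
  by rewrite fE.
have [_ ] := integrable_integral_uniform ab mf intf.
rewrite integral_mkcondr -fE => <-.
rewrite integral_mkcond fXE; apply: integral_uniform_law.
  exact/measurable_EFinP.
rewrite -fXE; apply/(integrable_mkcond _ mXD).
exact: integrableS (uniform_integrable c n).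
Qed.

Let ba0 : b - a != 0. Proof. by rewrite subr_eq0 gt_eqF. Qed.

Lemma uniform_mean : ('E_P[X] = ((a + b) / 2)%:E)%E.
Proof.
have := uniform_integral 0 1 (@measurableT _ R).
rewrite setIT integral_subrX ?ltW// preimage_setT unlock.
under eq_integral do rewrite subr0 expr1.
by move=> ->; rewrite -EFinM; congr EFin; field.
Qed.

Lemma uniform_variance : ('V_P[X] = ((b - a) ^+ 2 / 12)%:E)%E.
Proof.
have := uniform_integral ((a + b) / 2) 2 (@measurableT _ R).
rewrite setIT integral_subrX ?ltW// preimage_setT.
rewrite /variance unlock uniform_mean unlock/=.
under eq_integral do rewrite expr2.
by move=> ->; rewrite -EFinM; congr EFin; field.
Qed.

(** Depending on the signs of a and b, the point 0 may belong to only one of the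
    two sets; it is Lebesgue-negligible. *)
Lemma itv_vote_set s :
  (`[a, b] `&` vote_set s) `\ 0 = `[clip s a, clip s b]%classic `\ 0.
Proof.
apply/seteqP; split => x; rewrite /vote_set /clip /= !in_itv/=.
- case: s => -[[/andP[ax xb] xs] /eqP x0]; split; try exact/eqP.
  + by rewrite ge_max ax (ltW xs) le_max xb.
  + by rewrite ge_min ax le_min xb (leNgt x) xs.
- case: s => -[/andP[ax xb] /eqP x0]; split; try exact/eqP.
  + move: ax xb; rewrite ge_max le_max => /andP[-> x_ge0].
    have xp : 0 < x by rewrite lt_neqAle eq_sym x0.
    by rewrite leNgt (leNgt x) xp orbF.
  + move: ax xb; rewrite ge_min le_min => ax /andP[-> x_le0].
    have xn : x < 0 by rewrite lt_neqAle x0.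
    move: ax; rewrite (leNgt 0) xn orbF => ->; split => //.
    by rewrite ltNge x_le0.
Qed.

(** The exponents 0 and 1 give the probability of vote s and the integral of X
    over it. *)
Lemma uniform_vote_moment s (n : nat) :
  (\int[P]_(w in X @^-1` vote_set s) (X w ^+ n)%:E =
   ((b - a)^-1 * ((clip s b ^+ n.+1 - clip s a ^+ n.+1) / n.+1%:R))%:E)%E.
Proof.
have mV : measurable (vote_set s : set R) by exact: measurable_vote_set.
have := uniform_integral 0 n mV.
under eq_integral do rewrite subr0.
have mf (D : set R) : measurable_fun D (fun x : R => ((x - 0) ^+ n)%:E).
  by apply: measurable_funTS; apply/measurable_EFinP.
rewrite -(@integral_setD1 _ _ 0)//; last first.
  by apply: measurableD => //; exact: measurableI.
rewrite itv_vote_set integral_setD1//; last exact: measurableD.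
by rewrite integral_subrX ?clip_le ?ltW// !subr0 => ->.
Qed.

Lemma uniform_vote_prob s : P (X @^-1` vote_set s) = (vote_prob a b s)%:E.
Proof.
have mXV : measurable (X @^-1` vote_set s).
  by apply: measurable_funPTI; exact: measurable_vote_set.
have := uniform_vote_moment s 0.
under eq_integral do rewrite expr0.
rewrite integral_cst// mul1e => ->; congr EFin; rewrite /vote_prob; field.
by [].
Qed.

Lemma uniform_vote_mean s :
  (\int[P]_(w in X @^-1` vote_set s) (X w)%:E =
   (vote_prob a b s * vote_cmean a b s)%:E)%E.
Proof.
have := uniform_vote_moment s 1.
under eq_integral do rewrite expr1.
by move=> ->; congr EFin; rewrite /vote_prob /vote_cmean; field.
Qed.

End uniform_moments.

(** * The sign of the gain for the uniform law *)

(** Mean (a + b) / 2 and variance (b - a)^2 / 12 determine the end points. *)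
Lemma uniform_parameters (R : realType) d (T : measurableType d)
    (P : probability T R) (X : {RV P >-> R}) (mu sigma : R) :
  0 < sigma -> uniformly_distributed X ->
  ('E_P[X] = mu%:E)%E -> standard_deviation X = sigma%:E ->
  forall (ab : mu - Num.sqrt 3 * sigma < mu + Num.sqrt 3 * sigma) (A : set R),
    measurable A -> distribution P X A = uniform_prob ab A.
Proof.
move=> sigma0 [a [b [ab Xab]]] EX SX ab' A mA.
move: EX SX; rewrite (uniform_mean Xab) /standard_deviation.
rewrite (uniform_variance Xab)/= => -[muE] [sigmaE].
have ba : 0 < b - a by rewrite subr_gt0.
have s3 : Num.sqrt 3 ^+ 2 = 3 :> R by rewrite sqr_sqrtr.
have sE : sigma ^+ 2 = (b - a) ^+ 2 / 12.
  by rewrite -sigmaE sqr_sqrtr// divr_ge0// sqr_ge0.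
have baE : b - a = 2 * (Num.sqrt 3 * sigma).
  apply/eqP; rewrite -(eqrXn2 (_ : 0 < 2)%N)//; first last.
  - by rewrite mulr_ge0// mulr_ge0 ?sqrtr_ge0// ltW.
  - exact: ltW.
  by rewrite !exprMn s3 sE; apply/eqP; field.
have aE : a = mu - Num.sqrt 3 * sigma by lra.
have bE : b = mu + Num.sqrt 3 * sigma by lra.
by subst a b; rewrite (bool_irrelevance ab' ab); exact: Xab.
Qed.

Section uniform_threshold_sign.
Context (R : realType) (n : nat) (mu sigma : R).
Hypotheses (n0 : (0 < n)%N) (sigma0 : 0 < sigma).

Let h := Num.sqrt 3 * sigma.
Let a := mu - h.
Let b := mu + h.

Let h0 : 0 < h. Proof. by rewrite mulr_gt0// sqrtr_gt0. Qed.
Let s30 : 0 < Num.sqrt 3 :> R. Proof. by rewrite sqrtr_gt0. Qed.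

Let rho_le : (mu / sigma <= - Num.sqrt 3) = (b <= 0).
Proof. by rewrite ler_pdivrMr// mulNr -/h /b -subr_le0 opprK. Qed.

Let rho_lt : (mu / sigma < Num.sqrt 3) = (a < 0).
Proof. by rewrite ltr_pdivrMr// -/h /a subr_lt0. Qed.

Let thresholdE : a < 0 -> 0 < b ->
  uniform_threshold (mu / sigma) = - a / (b - a).
Proof.
move=> a0 b0; rewrite /uniform_threshold rho_le rho_lt (leNgt b) b0 a0 /=.
rewrite /a /b /h; field.
have s3 := s30; have h1 := h0; rewrite /h in h1.
rewrite !gt_eqF//; lra.
Qed.

Lemma uniform_threshold_admissible :
  admissible_threshold n (uniform_threshold (mu / sigma)).
Proof.
have nV : - (n%:R^-1 : R) <= 0 by rewrite oppr_le0 invr_ge0.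
rewrite /admissible_threshold.
have [b0|b0] := leP b 0.
  by rewrite /uniform_threshold rho_le b0 lexx (le_trans nV).
have [a0|a0] := ltP a 0.
  have ba : 0 < b - a by rewrite subr_gt0 (lt_trans a0).
  rewrite thresholdE// ler_pdivrMr// mul1r (le_trans nV)/=; first by lra.
  by rewrite divr_ge0 ?ltW// oppr_gt0.
rewrite /uniform_threshold rho_le rho_lt (leNgt b) b0/= (ltNge a) a0/=.
by rewrite nV ler01.
Qed.

(** For a < 0 < b the gain of S is (|S| (b - a) + n a) / 2.  Otherwise one vote
    has probability zero, so S is empty (b <= 0) or full (0 <= a), with gain
    n (a + b) / 2; the threshold 1 rejects the former, the threshold 0 accepts
    the latter. *)
Lemma pattern_gain_sign (S : {set 'I_n}) :
  pattern_weight (vote_prob a b) S != 0 ->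
  if uniform_threshold (mu / sigma) * n%:R < #|S|%:R
  then 0 <= pattern_gain (vote_cmean a b) S
  else pattern_gain (vote_cmean a b) S <= 0.
Proof.
move=> wS.
have unanimous s : vote_prob a b s = 0 -> forall k, (k \in S) = ~~ s.
  move=> ps0 k; have : (k \in S) != s.
    apply: contraNneq wS => kS; rewrite /pattern_weight (bigD1 k)//= kS ps0.
    by rewrite mul0r.
  by case: s {ps0}; case: (k \in S).
have a_lt_b : a < b by rewrite /a /b; have := h0; lra.
have Sn : (#|S| <= n)%N by rewrite -[n in (_ <= n)%N]card_ord max_card.
rewrite /pattern_gain natrB// /vote_cmean /clip.
have [b0|b0] := leP b 0.
  have a0 : a <= 0 by rewrite (le_trans (ltW a_lt_b)).
  have S0 : #|S| = 0%N.
    apply: eq_card0 => k; rewrite (unanimous true)//.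
    by rewrite /vote_prob /clip !max_r// subrr mul0r.
  rewrite S0 /uniform_threshold rho_le b0 mul1r ltr_nat ltn0.
  rewrite mul0r add0r subr0 !min_l//.
  by rewrite mulr_ge0_le0//; lra.
have [a0|a0] := ltP a 0; last first.
  have ST : #|S| = n.
    rewrite -[RHS]card_ord; apply: eq_card => k; rewrite (unanimous false)//.
    by rewrite /vote_prob /clip !min_r// ?subrr ?mul0r// ltW.
  rewrite ST /uniform_threshold rho_le rho_lt (leNgt b) b0/= (ltNge a) a0/=.
  rewrite mul0r ltr0n n0 subrr mul0r addr0.
  by rewrite mulr_ge0//; lra.
rewrite thresholdE//.
have ba : 0 < b - a by rewrite subr_gt0.
rewrite mulrAC ltr_pdivrMr//.
by case: ltP => ?; nra.
Qed.

End uniform_threshold_sign.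

Theorem corollary3 (R : realType) (d : measure_display) (T : measurableType d)
    (P : probability T R) (n : nat) (zeta : 'I_n -> {RV P >-> R})
    (mu sigma : R) :
  (1 <= n)%N ->
  0 < sigma ->
  mutually_independent zeta ->
  (forall i, uniformly_distributed (zeta i)) ->
  (forall i, 'E_P[zeta i]%E = mu%:E) ->
  (forall i, standard_deviation (zeta i) = sigma%:E) ->
  optimal_threshold zeta (uniform_threshold (mu / sigma)).
Proof.
move=> n0 sigma0 indep unif mean sd.
have ab : mu - Num.sqrt 3 * sigma < mu + Num.sqrt 3 * sigma.
  have : 0 < Num.sqrt 3 * sigma by rewrite mulr_gt0// sqrtr_gt0.
  lra.
have law i (A : set R) : measurable A ->
    distribution P (zeta i) A = uniform_prob ab A.
  exact: (uniform_parameters sigma0).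
split=> [|alpha i _]; first exact: uniform_threshold_admissible.
have intz k : P.-integrable setT (EFin \o zeta k).
  have := uniform_integrable (law k) 0 1; congr (_.-integrable _ _).
  by apply/funext => w /=; rewrite subr0.
rewrite !(expected_incrementE indep (fun k => uniform_vote_prob (law k)) intz
  (fun k => uniform_vote_mean (law k))) lee_fin.
apply: mean_increment_max; last by move=> S; exact: pattern_gain_sign.
move=> s; rewrite /vote_prob divr_ge0// subr_ge0; last exact: ltW.
by apply: clip_le; exact: ltW.
Qed.
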